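(* Fix $c\in(1,\infty)$. Let $(K_i)_{i\ge1}$ be irreducible Markov kernels on a finite set $V$, $c$-stable with respect to a positive probability measure $\mu_0$; set $\mu_n=\mu_0K_{0,n}$. For each $i$ set $\mu_0^i=\mu_0K_i$, let $\sigma_1(K_i,\mu_0^i)$ be the second largest singular value of $K_i:\ell^2(\mu_0^i)\to\ell^2(\mu_0)$, and let $l(K_i^*K_i)$ be the logarithmic Sobolev constant of $K_i^*K_i:\ell^2(\mu_0^i)\to\ell^2(\mu_0^i)$, where $K_i^*$ is the adjoint of $K_i:\ell^2(\mu_0^i)\to\ell^2(\mu_0)$. For $x\in V$ let \[\tilde m_x=\min\Bigl\{t\in\mathbb N:\sum_{i=1}^t\log\bigl(1+c^{-2}l(K_i^*K_i)\bigr)\ge\log\log\bigl(\mu_0(x)^{-1/2}\bigr)\Bigr\}.\] Then for $n\ge\tilde m_x$, \[d_2(K_{0,n}(x,\cdot),\mu_n)^2\le e^2\prod_{i=\tilde m_x+1}^n\Bigl(1-c^{-2}\bigl(1-\sigma_1(K_i,\mu_0^i)^2\bigr)\Bigr).\]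
   Context: $K_{0,n}=K_1\cdots K_n$. $c$-stability w.r.t. $\mu_0$: $c^{-1}\le\mu_n(x)/\mu_0(x)\le c$ for all $n\ge0$, $x\in V$. $K_i^*K_i$ has kernel $\frac{1}{\mu_0^i(x)}\sum_z\mu_0(z)K_i(z,x)K_i(z,y)$, reversible w.r.t. $\mu_0^i$; its second largest eigenvalue is $\sigma_1(K_i,\mu_0^i)^2$. For $P$ reversible w.r.t. $\nu$: $\mathcal E_{P,\nu}(f,f)=\frac12\sum_{x,y}|f(x)-f(y)|^2\nu(x)P(x,y)$, $\mathcal L(f^2,\nu)=\sum_xf^2\log(f^2/\|f\|^2_{\ell^2(\nu)})\nu(x)$, $l(P)=\inf\{\mathcal E_{P,\nu}(f,f)/\mathcal L(f^2,\nu):\mathcal L(f^2,\nu)\ne0,\ f\text{ nonconstant}\}$. $d_2(K_{0,n}(x,\cdot),\mu_n)=(\sum_y|K_{0,n}(x,y)/\mu_n(y)-1|^2\mu_n(y))^{1/2}$. *)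

(* Defs.v *)
From HB Require Import structures.
From mathcomp Require Import all_boot all_order all_algebra.
From mathcomp Require Import all_classical all_reals all_analysis.
Set Implicit Arguments. Unset Strict Implicit. Unset Printing Implicit Defensive.
Import Order.TTheory GRing.Theory Num.Theory.
Local Open Scope ring_scope.
Local Open Scope classical_set_scope.

Section Defs.
Variables (R : realType) (V : finType).

Definition mkernel := V -> V -> R.
Definition mmeas := V -> R.

Definition markov_kernel (K : mkernel) : Prop :=
  (forall x y, 0 <= K x y) /\ (forall x, \sum_y K x y = 1).

Definition kid : mkernel := fun x y => if x == y then 1 else 0.
Definition kcomp (K L : mkernel) : mkernel := fun x y => \sum_z K x z * L z y.
Fixpoint kpow (K : mkernel) (k : nat) : mkernel :=
  if k is k'.+1 then kcomp (kpow K k') K else kid.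

Definition irreducible_kernel (K : mkernel) : Prop :=
  forall x y, exists k, 0 < kpow K k x y.

(* K_{0,n} = K_1 ... K_n  (K 0 is never used) *)
Fixpoint Kprod (K : nat -> mkernel) (n : nat) : mkernel :=
  if n is n'.+1 then kcomp (Kprod K n') (K n) else kid.

Definition mact (mu : mmeas) (K : mkernel) : mmeas := fun y => \sum_x mu x * K x y.

Definition positive_prob (mu : mmeas) : Prop :=
  (forall x, 0 < mu x) /\ \sum_x mu x = 1.

Definition c_stable (c : R) (K : nat -> mkernel) (mu0 : mmeas) : Prop :=
  forall n x, c^-1 <= mact mu0 (Kprod K n) x / mu0 x <= c.

(* mkernel of K^* K : l^2(mu0 K) -> l^2(mu0 K), K^* adjoint of K : l^2(mu0 K) -> l^2(mu0) *)
Definition adjK_K (mu0 : mmeas) (K : mkernel) : mkernel :=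
  fun x y => (mact mu0 K x)^-1 * \sum_z mu0 z * K z x * K z y.

Definition kmx (P : mkernel) : 'M[R]_#|V| :=
  \matrix_(i, j) P (enum_val i) (enum_val j).

(* eigenvalues of a square real matrix with algebraic multiplicity, when the
   characteristic polynomial splits over R (default [::] otherwise) *)
Definition eigen_seq n (A : 'M[R]_n) : seq R :=
  xget [::] (fun s : seq R => char_poly A = \prod_(r <- s) ('X - r%:P)).

Definition second_eig n (A : 'M[R]_n) : R :=
  nth 0 (sort (fun a b : R => b <= a) (eigen_seq A)) 1.

(* sigma_1(K, mu0 K): second largest singular value of K : l^2(mu0 K) -> l^2(mu0),
   i.e. the square root of the second largest eigenvalue of K^* K *)
Definition sigma1 (mu0 : mmeas) (K : mkernel) : R :=
  Num.sqrt (second_eig (kmx (adjK_K mu0 K))).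

Definition dirichlet (P : mkernel) (nu : mmeas) (f : V -> R) : R :=
  2^-1 * \sum_x \sum_y (f x - f y) ^+ 2 * nu x * P x y.

Definition l2norm2 (nu : mmeas) (f : V -> R) : R := \sum_x f x ^+ 2 * nu x.

Definition entropyL (nu : mmeas) (f : V -> R) : R :=
  \sum_x f x ^+ 2 * ln (f x ^+ 2 / l2norm2 nu f) * nu x.

Definition logsob (P : mkernel) (nu : mmeas) : R :=
  inf [set r : R | exists f : V -> R,
         (exists x y, f x != f y) /\ entropyL nu f != 0 /\
         r = dirichlet P nu f / entropyL nu f].

Definition d2 (p mu : mmeas) : R :=
  Num.sqrt (\sum_y (p y / mu y - 1) ^+ 2 * mu y).

End Defs.

Section Mtilde.
Variables (R : realType) (V : finType).
Local Open Scope ring_scope.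
Definition mtilde_cond (c : R) (K : nat -> mkernel R V) (mu0 : mmeas R V) (x : V)
  (t : nat) : Prop :=
  ln (ln (mu0 x `^ (- 2^-1))) <=
  \sum_(1 <= i < t.+1) ln (1 + c ^- 2 * logsob (adjK_K mu0 (K i)) (mact mu0 (K i))).
End Mtilde.

(* Main.v *)
Require Import Defs.
From HB Require Import structures.
From mathcomp Require Import all_boot all_order all_algebra.
From mathcomp Require Import all_classical all_reals all_analysis.
From mathcomp Require Import complex ring lra.
Import Order.TTheory GRing.Theory Num.Theory.
Local Open Scope ring_scope.

Set Implicit Arguments.
Unset Strict Implicit.
Unset Printing Implicit Defensive.

(* Write mu_n = mu_0 K_{0,n} and l_i = c^-2 l(K_i^* K_i).  Stability lets one compare
   Dirichlet forms, entropies and variances taken along (mu_n) with those taken from mu_0,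
   so K_i^* K_i, with adjoint for mu_{i-1} and mu_i, has logarithmic Sobolev constant at
   least l_i and spectral gap at least c^-2 (1 - sigma_1(K_i, mu_0^i)^2).  A single step is
   a contraction from l^p(mu_i) to l^{p (1 + l_i)}(mu_{i-1}) for p >= 2, hence K_{0,n} is
   a contraction from l^2(mu_n) to l^q(mu_0), q = 2 prod_i (1 + l_i).  Testing this on the
   normalised density of K_{0,n}(x, .) and keeping only the atom at x bounds its l^2(mu_n)
   norm by mu_0(x)^(-1/q), which is at most e when n = mt.  Afterwards each
   step contracts mean-zero functions by the spectral gap. *)

(** * Second eigenvalue of a real symmetric matrix *)

Lemma char_poly_conj (F : comNzRingType) (n : nat) (P Q A : 'M[F]_n) :
  P *m Q = 1%:M -> char_poly (P *m A *m Q) = char_poly A.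
Proof.
move=> PQ; have QP := mulmx1C PQ.
pose p := map_mx polyC P; pose q := map_mx polyC Q.
have pq : p *m q = 1%:M by rewrite -map_mxM PQ map_mx1.
have qp : q *m p = 1%:M by rewrite -map_mxM QP map_mx1.
rewrite /char_poly; have -> : char_poly_mx (P *m A *m Q) = p *m char_poly_mx A *m q.
  by rewrite /char_poly_mx mulmxBr mulmxBl !map_mxM mul_mx_scalar -scalemxAl pq scalemx1.
by rewrite !det_mulmx mulrC mulrA -det_mulmx qp det1 mul1r.
Qed.

(** A real symmetric matrix is hermitian over [R[i]], so the complex spectral theorem applies. Its
    eigenvalues are real, hence [d] takes values in [R], while the diagonalising [P] stays complex
    unitary. *)
Lemma real_symmetric_diag (R : rcfType) (n : nat) (A : 'M[R]_n) : A^T = A ->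
  exists (P : 'M[R[i]]_n) (d : 'I_n -> R),
    P *m map_mx Num.conj P^T = 1%:M /\
    map_mx (real_complex R) A =
      map_mx Num.conj P^T *m diag_mx (\row_i real_complex R (d i)) *m P.
Proof.
move=> symA; set B := map_mx _ A.
have Bherm : B \is hermsymmx.
  apply/is_hermitianmxP; rewrite expr0 scale1r.
  apply/matrixP => i j; rewrite !mxE -{1}symA mxE.
  by rewrite (CrealP _) //; apply/complex_realP; exists (A j i).
have /orthomx_spectralP := hermitian_normalmx Bherm.
have := hermitian_spectral_diag_real Bherm.
have := spectral_unitarymx B.
move: (spectralmx B) (spectral_diag B) => P d Pu dreal ->.
exists P, (fun i => complex.Re (d 0 i)); split; first exact/unitarymxP.
rewrite invmx_unitary //.
do 2!congr (_ *m _); congr diag_mx; apply/rowP => i; rewrite mxE.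
by rewrite RRe_real //; exact/mxOverP.
Qed.

Lemma char_poly_diag (F : comNzRingType) (n : nat) (d : 'rV[F]_n) :
  char_poly (diag_mx d) = \prod_(i < n) ('X - (d 0 i)%:P).
Proof.
rewrite char_poly_trig; last exact: diag_mx_is_trig.
by apply: eq_bigr => i _; rewrite mxE eqxx.
Qed.

(** An index [i0], rather than a value, is singled out for the head of the sorted list: a repeated
    top eigenvalue then still occurs in the tail, whose head is [second_eig A]. *)
Lemma second_eig_bound (R : realType) (n : nat) (A : 'M[R]_n) (d : 'I_n -> R) :
  (0 < n)%N -> char_poly A = \prod_(i < n) ('X - (d i)%:P) ->
  exists i0, forall i, i != i0 -> d i <= second_eig A.
Proof.
move=> n_gt0 cA; rewrite /second_eig.
set t := sort _ _.
have perm_t : perm_eq t [seq d i | i <- enum 'I_n].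
  rewrite perm_sort; apply: prod_XsubC_eq.
  rewrite big_map big_enum /= -cA /eigen_seq.
  (* The list of the [d i] is a valid factorisation, so [xget] does not fall back on [[::]]; two
     factorisations agree up to permutation. *)
  case: xgetP => [s _ <-//|/(_ [seq d i | i <- enum 'I_n])] [].
  by rewrite big_map big_enum.
have sorted_t : sorted (fun a b : R => b <= a) t.
  by apply: sort_sorted => a b; exact: le_total.
move: t perm_t sorted_t => [|a t] perm_t sorted_t.
  by move/perm_size: perm_t; rewrite size_map size_enum_ord /= => /eqP; rewrite ltn_eqF.
have /mapP[i0 _ ai0] : a \in [seq d i | i <- enum 'I_n].
  by rewrite -(perm_mem perm_t) mem_head.
exists i0 => i ii0 /=.
have i0_enum : i0 \in enum 'I_n by rewrite mem_enum.
have : d i \in t.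
  have : perm_eq (a :: t) (a :: [seq d i | i <- rem i0 (enum 'I_n)]).
    rewrite (perm_trans perm_t) //.
    by rewrite (perm_trans (perm_map d (perm_to_rem i0_enum))) //= ai0.
  rewrite perm_cons => /perm_mem ->; apply: map_f.
  by rewrite mem_rem_uniq ?enum_uniq // inE ii0 mem_enum.
case: t sorted_t {perm_t} => // b t /= /andP[_ pt].
rewrite inE => /predU1P[->//|dit].
have tr : transitive (fun a b : R => b <= a) by move=> y x z xy yz; exact: le_trans yz xy.
by have /allP /(_ _ dit) := order_path_min tr pt.
Qed.

(** If [second_eig A >= 1], the last hypothesis suffices. Otherwise only [d i0] can equal 1, so the
    fixed vector [v] lies on the axis [i0] of the eigenbasis, and [f], orthogonal to [v], has no
    component there. *)
Lemma second_eig_rayleigh (R : realType) (n : nat) (A : 'M[R]_n) (v f : 'rV[R]_n) :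
  A^T = A -> v != 0 -> v *m A = v -> f *m v^T = 0 ->
  (f *m A *m f^T) 0 0 <= (f *m f^T) 0 0 ->
  (f *m A *m f^T) 0 0 <= second_eig A * (f *m f^T) 0 0.
Proof.
move=> symA v0 vA fv fA_le.
have n_gt0 : (0 < n)%N.
  by case: n v {A f symA vA fv fA_le} v0 => // v; rewrite thinmx0 eqxx.
have ff_ge0 : 0 <= (f *m f^T) 0 0.
  by rewrite mxE sumr_ge0 // => i _; rewrite mxE -expr2 sqr_ge0.
have [s1|s1] := leP 1 (second_eig A).
  by rewrite (le_trans fA_le) // ler_peMl.
have [P [d [PP AP]]] := real_symmetric_diag symA.
have PP' := mulmx1C PP.
have cA : char_poly A = \prod_(i < n) ('X - (d i)%:P).
  apply: (map_poly_inj (real_complex R)).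
  rewrite map_char_poly AP char_poly_conj // char_poly_diag rmorph_prod.
  by apply: eq_bigr => i _; rewrite /= mxE map_polyXsubC.
have [i0 i0P] := second_eig_bound n_gt0 cA.
(* Coordinates in the unitary eigenbasis; [dot] and [quad] are Parseval's identity and the diagonal
   form of [A]. *)
pose coord (u : 'rV[R]_n) := map_mx (real_complex R) u *m map_mx Num.conj P^T.
have coordK u : coord u *m P = map_mx (real_complex R) u by rewrite -mulmxA PP' mulmx1.
have mapT u : map_mx (real_complex R) u^T = map_mx Num.conj P^T *m map_mx Num.conj (coord u)^T.
  rewrite -map_mxM -trmx_mul coordK; apply/matrixP => i j; rewrite !mxE.
  by apply/esym/CrealP/complex_realP; exists (u j i).
have dot (u w : 'rV[R]_n) :
    real_complex R ((u *m w^T) 0 0) = \sum_i coord u 0 i * Num.conj (coord w 0 i).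
  transitivity (map_mx (real_complex R) (u *m w^T) 0 0); first by rewrite [RHS]mxE.
  rewrite map_mxM mapT mulmxA -/(coord u) mxE.
  by apply: eq_bigr => i _; rewrite !mxE.
have quad : real_complex R ((f *m A *m f^T) 0 0) =
    \sum_i real_complex R (d i) * (coord f 0 i * Num.conj (coord f 0 i)).
  transitivity (map_mx (real_complex R) (f *m A *m f^T) 0 0); first by rewrite [RHS]mxE.
  rewrite !map_mxM mapT AP !mulmxA -/(coord f).
  rewrite -[coord f *m _ *m P *m _]mulmxA PP mulmx1 mul_mx_diag mxE.
  by apply: eq_bigr => i _; rewrite !mxE mulrAC mulrC.
have coord_v i : i != i0 -> coord v 0 i = 0.
  move=> /i0P di.
  have : coord v *m diag_mx (\row_i real_complex R (d i)) = coord v.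
    rewrite -[RHS]mulmx1 -PP -[LHS]mulmx1 -PP !mulmxA.
    congr (_ *m _); rewrite coordK /coord -!mulmxA [_ *m (_ *m P)]mulmxA.
    by rewrite -AP -map_mxM vA.
  move/rowP/(_ i); rewrite mul_mx_diag mxE [X in _ * X]mxE.
  move: (coord v 0 i) => z /eqP.
  rewrite -subr_eq0 -{2}[z]mulr1 -mulrBr mulf_eq0 => /orP[/eqP//|].
  rewrite -(rmorph1 (real_complex R)) -rmorphB /= fmorph_eq0 subr_eq0 => /eqP d1.
  by move: (le_lt_trans di s1); rewrite d1 ltxx.
have f_i0 : coord f 0 i0 = 0.
  have := dot f v; rewrite fv mxE rmorph0 (bigD1 i0) //= big1 ?addr0; last first.
    by move=> i /coord_v ->; rewrite rmorph0 mulr0.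
  move/esym/eqP; rewrite mulf_eq0 conjC_eq0 => /orP[/eqP//|/eqP v_i0].
  suff : v = 0 by move/eqP: v0.
  apply: (@map_mx_inj _ _ (real_complex R)); rewrite map_mx0 -coordK.
  suff -> : coord v = 0 by rewrite mul0mx.
  by apply/rowP => i; rewrite [RHS]mxE; have [->|/coord_v] := eqVneq i i0.
rewrite -lecR rmorphM /= quad dot mulr_sumr; apply: ler_sum => i _.
have [->|ii0] := eqVneq i i0; first by rewrite f_i0 mul0r !mulr0.
by rewrite ler_wpM2r ?mul_conjC_ge0 // lecR i0P.
Qed.

(** * Dirichlet forms and adjoints *)

Definition kact (R : realType) (V : finType) (K : mkernel R V) (f : V -> R) : V -> R :=
  fun x => \sum_y K x y * f y.

Lemma sum_mact (R : realType) (V : finType) (mu : mmeas R V) (K : mkernel R V)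
    (f : V -> R) :
  \sum_y f y * mact mu K y = \sum_x mu x * kact K f x.
Proof.
rewrite /mact /kact; under eq_bigr do rewrite mulr_sumr.
rewrite exchange_big /=; apply: eq_bigr => x _; rewrite mulr_sumr.
by apply: eq_bigr => y _; ring.
Qed.

Lemma mact_kcomp (R : realType) (V : finType) (mu : mmeas R V) (K L : mkernel R V) :
  mact mu (Defs.kcomp K L) = mact (mact mu K) L.
Proof.
apply/funext => y; rewrite /mact /Defs.kcomp; under eq_bigr do rewrite mulr_sumr.
rewrite exchange_big /=; apply: eq_bigr => z _; rewrite mulr_suml.
by apply: eq_bigr => x _; ring.
Qed.

Lemma mact_kid (R : realType) (V : finType) (mu : mmeas R V) : mact mu (@kid R V) = mu.
Proof.
apply/funext => y; rewrite /mact /kid (bigD1 y) //= eqxx mulr1 big1 ?addr0 //.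
by move=> x /negPf ->; rewrite mulr0.
Qed.

Lemma kact_kcomp (R : realType) (V : finType) (K L : mkernel R V) (f : V -> R) :
  kact (Defs.kcomp K L) f = kact K (kact L f).
Proof.
apply/funext => x; rewrite /kact /Defs.kcomp; under eq_bigr do rewrite mulr_suml.
rewrite exchange_big /=; apply: eq_bigr => z _; rewrite mulr_sumr.
by apply: eq_bigr => y _; ring.
Qed.

Lemma kact_kid (R : realType) (V : finType) (f : V -> R) : kact (@kid R V) f = f.
Proof.
apply/funext => x; rewrite /kact /kid (bigD1 x) //= eqxx mul1r big1 ?addr0 //.
by move=> y; rewrite eq_sym => /negPf ->; rewrite mul0r.
Qed.

(** The weight [mact mu K x] cancels the normalisation of [adjK_K]. What remains is linear in [mu]
    with nonnegative coefficients when [K] is nonnegative, which makes different base measures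
    comparable. *)
Lemma dirichlet_adjK_K (R : realType) (V : finType) (mu : mmeas R V)
    (K : mkernel R V) (f : V -> R) :
  (forall x, 0 < mact mu K x) ->
  dirichlet (adjK_K mu K) (mact mu K) f =
  \sum_z mu z * (2^-1 * \sum_x \sum_y (f x - f y) ^+ 2 * (K z x * K z y)).
Proof.
move=> nu_gt0; rewrite /dirichlet.
under [RHS]eq_bigr do rewrite mulrCA mulr_sumr.
rewrite -mulr_sumr; congr (_ * _).
rewrite [RHS]exchange_big /=; apply: eq_bigr => x _.
under [RHS]eq_bigr do rewrite mulr_sumr.
rewrite [RHS]exchange_big /=; apply: eq_bigr => y _.
rewrite /adjK_K -mulrA mulVKf ?gt_eqF // mulr_sumr.
by apply: eq_bigr => z _; ring.
Qed.

Lemma half_sum_sqr_diff (R : realType) (V : finType) (k f : V -> R) :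
  \sum_y k y = 1 ->
  2^-1 * (\sum_x \sum_y (f x - f y) ^+ 2 * (k x * k y)) =
  \sum_y k y * f y ^+ 2 - (\sum_y k y * f y) ^+ 2.
Proof.
move=> k1; set a := \sum_y k y * f y ^+ 2; set b := \sum_y k y * f y.
suff -> : \sum_x \sum_y (f x - f y) ^+ 2 * (k x * k y) = 2 * a - 2 * b ^+ 2.
  by rewrite -mulrBr mulKf.
transitivity (\sum_x (k x * f x ^+ 2 + k x * a - 2 * b * (k x * f x))); last first.
  rewrite !big_split /= -!mulr_suml k1 sumrN -mulr_sumr -/a -/b; ring.
apply: eq_bigr => x _.
transitivity (\sum_y (k x * f x ^+ 2 * k y + k x * (k y * f y ^+ 2)
                      - 2 * (k x * f x) * (k y * f y))).
  by apply: eq_bigr => y _; ring.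
rewrite !big_split /= sumrN -!mulr_sumr k1 -/a -/b; ring.
Qed.

(** The Dirichlet form is the loss of squared norm under [K], so a lower bound on it is a
    contraction estimate. Each row [K z] contributes the variance of [f] under it. *)
Lemma dirichlet_adjK_K_variance (R : realType) (V : finType) (mu : mmeas R V)
    (K : mkernel R V) (f : V -> R) :
  markov_kernel K -> (forall x, 0 < mact mu K x) ->
  dirichlet (adjK_K mu K) (mact mu K) f =
  \sum_y f y ^+ 2 * mact mu K y - \sum_z mu z * kact K f z ^+ 2.
Proof.
move=> [_ K1] nu_gt0; rewrite dirichlet_adjK_K // sum_mact -sumrB.
by apply: eq_bigr => z _; rewrite half_sum_sqr_diff // mulrBr.
Qed.

Lemma dirichlet_ge0 (R : realType) (V : finType) (P : mkernel R V) (nu : mmeas R V)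
    (f : V -> R) :
  (forall x y, 0 <= P x y) -> (forall x, 0 <= nu x) -> 0 <= dirichlet P nu f.
Proof.
move=> P0 nu0; rewrite /dirichlet mulr_ge0 ?invr_ge0 ?ler0n //.
by apply: sumr_ge0 => x _; apply: sumr_ge0 => y _; rewrite mulr_ge0 // mulr_ge0 ?sqr_ge0.
Qed.

Lemma adjK_K_ge0 (R : realType) (V : finType) (mu : mmeas R V) (K : mkernel R V) x y :
  (forall x, 0 <= mu x) -> (forall x y, 0 <= K x y) -> 0 <= adjK_K mu K x y.
Proof.
move=> mu0 K0; rewrite /adjK_K mulr_ge0 ?invr_ge0 ?sumr_ge0 // => z _.
  by rewrite mulr_ge0.
by rewrite !mulr_ge0.
Qed.

Lemma ler_dirichlet (R : realType) (V : finType) (mu mu' : mmeas R V)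
    (K : mkernel R V) (a : R) (f : V -> R) :
  (forall x y, 0 <= K x y) ->
  (forall x, 0 < mact mu K x) -> (forall x, 0 < mact mu' K x) ->
  (forall x, a * mu x <= mu' x) ->
  a * dirichlet (adjK_K mu K) (mact mu K) f <=
  dirichlet (adjK_K mu' K) (mact mu' K) f.
Proof.
move=> K0 nu0 nu0' amu; rewrite !dirichlet_adjK_K // mulr_sumr.
apply: ler_sum => z _; rewrite mulrA ler_wpM2r // mulr_ge0 ?invr_ge0 ?ler0n //.
by apply: sumr_ge0 => x _; apply: sumr_ge0 => y _; rewrite mulr_ge0 ?sqr_ge0 // mulr_ge0.
Qed.

(** * Entropy and the logarithmic Sobolev constant *)

(** This is [ln u <= u - 1] at [u = a / t], the pointwise form of nonnegativity of relative
    entropy. *)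
Lemma ler_subr_mulr_ln (R : realType) (t a : R) : 0 <= t -> 0 < a -> t - a <= t * ln (t / a).
Proof.
rewrite le_eqVlt => /predU1P[<-|t0] a0; first by rewrite mul0r sub0r oppr_le0 ltW.
have at0 : 0 < a / t by rewrite divr_gt0.
have : ln (a / t) <= a / t - 1.
  by rewrite -[X in ln X](subrK 1) addrC le_ln1Dx // ltrBrDl subrr.
rewrite -[t / a]invf_div lnV ?posrE // -(ler_pM2l t0) mulrN.
have -> : t * (a / t - 1) = a - t by field; rewrite gt_eqF.
by rewrite -lerN2 opprB.
Qed.

Lemma entropyL_ge0 (R : realType) (V : finType) (nu : mmeas R V) (f : V -> R) :
  (forall x, 0 <= nu x) -> \sum_x nu x = 1 -> 0 <= entropyL nu f.
Proof.
move=> nu0 nu1; rewrite /entropyL; set N := l2norm2 nu f.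
have : 0 <= N by apply: sumr_ge0 => x _; rewrite mulr_ge0 ?sqr_ge0.
rewrite le_eqVlt => /predU1P[/esym N0|N_gt0].
  by rewrite N0; apply: sumr_ge0 => x _; rewrite invr0 mulr0 ln0 // mulr0 mul0r.
rewrite [leLHS](_ : 0 = \sum_x (f x ^+ 2 - N) * nu x); last first.
  under eq_bigr do rewrite mulrBl.
  by rewrite sumrB -mulr_sumr nu1 mulr1 -/(l2norm2 nu f) subrr.
by apply: ler_sum => x _; rewrite ler_wpM2r // ler_subr_mulr_ln ?sqr_ge0.
Qed.

(* [N] minimises [a |-> \sum_x (f x ^+ 2 * ln (f x ^+ 2 / a) - f x ^+ 2 + a) * nu x],
   a sum which is monotone in [nu] because its summands are nonnegative. *)
Lemma ler_entropyL (R : realType) (V : finType) (nu nu' : mmeas R V) (c : R)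
    (f : V -> R) :
  0 <= c -> (forall x, 0 < nu x) -> (forall x, 0 <= nu' x) ->
  \sum_x nu x = 1 -> \sum_x nu' x = 1 -> (forall x, nu' x <= c * nu x) ->
  entropyL nu' f <= c * entropyL nu f.
Proof.
move=> c0 nu_gt0 nu'0 nu1 nu'1 le_nu.
have fnu0 x : 0 <= f x ^+ 2 * nu x by rewrite mulr_ge0 ?sqr_ge0 // ltW.
have fnu'0 x : 0 <= f x ^+ 2 * nu' x by rewrite mulr_ge0 ?sqr_ge0.
set N := l2norm2 nu f; set N' := l2norm2 nu' f.
have : 0 <= N' by apply: sumr_ge0.
rewrite le_eqVlt => /predU1P[N'0|N'_gt0].
  rewrite {1}/entropyL -/N' -N'0 big1; last first.
    by move=> x _; rewrite invr0 mulr0 ln0 // mulr0 mul0r.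
  by rewrite mulr_ge0 // entropyL_ge0 // => x; rewrite ltW.
have N_gt0 : 0 < N.
  rewrite -(pmulr_rgt0 _ (_ : 0 < c)); last first.
    rewrite lt_def c0 andbT; apply/eqP => c00; move: N'_gt0.
    rewrite /N' /l2norm2 big1 ?ltxx // => x _.
    by have := nu'0 x; have := le_nu x; rewrite c00 mul0r => ? ?;
      rewrite (_ : nu' x = 0) ?mulr0 //; apply/eqP; rewrite eq_le; apply/andP.
  apply: lt_le_trans N'_gt0 _; rewrite /N /N' /l2norm2 mulr_sumr.
  by apply: ler_sum => x _; rewrite mulrCA ler_wpM2l ?sqr_ge0.
have phi0 x : 0 <= f x ^+ 2 * ln (f x ^+ 2 / N) - f x ^+ 2 + N.
  by have := ler_subr_mulr_ln (sqr_ge0 (f x)) N_gt0; lra.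
have phiE : \sum_x (f x ^+ 2 * ln (f x ^+ 2 / N) - f x ^+ 2 + N) * nu x = entropyL nu f.
  under eq_bigr do rewrite mulrDl mulrBl.
  rewrite big_split sumrB /= -mulr_sumr nu1 mulr1 -/(l2norm2 nu f) -/N -/(entropyL nu f); ring.
(* For [nu'] the value at [N] exceeds the minimum, attained at [N'], by [N' * ln (N' / N) - N' + N],
   which is nonnegative. *)
have phiE' : \sum_x (f x ^+ 2 * ln (f x ^+ 2 / N) - f x ^+ 2 + N) * nu' x =
    entropyL nu' f + (N' * ln (N' / N) - N' + N).
  under eq_bigr do rewrite mulrDl mulrBl.
  rewrite big_split sumrB /= -mulr_sumr nu'1 mulr1 -/(l2norm2 nu' f) -/N'.
  suff -> : \sum_x f x ^+ 2 * ln (f x ^+ 2 / N) * nu' x =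
            entropyL nu' f + N' * ln (N' / N) by ring.
  rewrite [N' * _]mulr_suml -big_split /=; apply: eq_bigr => x _; rewrite -/N'.
  have [->|fx0] := eqVneq (f x) 0; first by rewrite expr0n /= !mul0r addr0.
  have fx_gt0 : 0 < f x ^+ 2 by rewrite exprn_even_gt0.
  by rewrite !ln_div ?posrE //; ring.
rewrite -phiE; apply: (@le_trans _ _ (entropyL nu' f + (N' * ln (N' / N) - N' + N))).
  by have := ler_subr_mulr_ln (ltW N'_gt0) N_gt0; lra.
by rewrite -phiE' mulr_sumr; apply: ler_sum => x _; rewrite mulrCA ler_wpM2l.
Qed.

Lemma logsob_lbound (R : realType) (V : finType) (P : mkernel R V) (nu : mmeas R V) :
  (forall x y, 0 <= P x y) -> (forall x, 0 <= nu x) -> \sum_x nu x = 1 ->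
  lbound [set r : R | exists f : V -> R,
         (exists x y, f x != f y) /\ entropyL nu f != 0 /\
         r = dirichlet P nu f / entropyL nu f]%classic 0.
Proof.
move=> P0 nu0 nu1 _ [f [_ [_ ->]]].
by rewrite divr_ge0 ?dirichlet_ge0 ?entropyL_ge0.
Qed.

Lemma logsob_ge0 (R : realType) (V : finType) (P : mkernel R V) (nu : mmeas R V) :
  (forall x y, 0 <= P x y) -> (forall x, 0 <= nu x) -> \sum_x nu x = 1 ->
  0 <= logsob P nu.
Proof.
move=> P0 nu0 nu1; rewrite /logsob; set E := [set r | _]%classic.
(* The set is empty when [V] has one point, for instance; its [inf] is then 0 by convention. *)
have [/eqP E0|/set0P E0] := boolP (E == set0); first by rewrite E0 inf0.
by apply: lb_le_inf => //; exact: logsob_lbound.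
Qed.

Lemma logsob_inequality (R : realType) (V : finType) (P : mkernel R V)
    (nu : mmeas R V) (f : V -> R) :
  (forall x y, 0 <= P x y) -> (forall x, 0 <= nu x) -> \sum_x nu x = 1 ->
  logsob P nu * entropyL nu f <= dirichlet P nu f.
Proof.
move=> P0 nu0 nu1.
have [->|L0] := eqVneq (entropyL nu f) 0; first by rewrite mulr0 dirichlet_ge0.
have L_gt0 : 0 < entropyL nu f by rewrite lt_def L0 entropyL_ge0.
rewrite -ler_pdivlMr //; apply: ge_inf; first by exists 0; exact: logsob_lbound.
exists f; split=> //; apply/not_existsP => cst.
have {}cst x y : f x = f y.
  by have [//|fxy] := eqVneq (f x) (f y); case: (cst x); exists y.
move/eqP: L0; apply; rewrite /entropyL big1 // => x _.
have -> : l2norm2 nu f = f x ^+ 2.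
  rewrite /l2norm2 -[RHS]mulr1 -nu1 mulr_sumr; apply: eq_bigr => y _.
  by rewrite (cst y x).
have [->|fx0] := eqVneq (f x) 0; first by rewrite expr0n /= !mul0r.
by rewrite divff ?expf_neq0 // ln1 mulr0 mul0r.
Qed.

(** * Hypercontractivity *)

(** For [s > 1] this is Young's inequality for [x] and 1 with conjugate exponents [s] and
    [s / (s - 1)]. *)
Lemma bernoulli_powR (R : realType) (x s : R) : 0 <= x -> 1 <= s -> 1 + s * (x - 1) <= x `^ s.
Proof.
move=> x0; rewrite le_eqVlt => /predU1P[<-|s1]; first by rewrite powRr1 //; lra.
have s0 : 0 < s by lra.
have := @conjugate_powR _ x 1 s (s / (s - 1)) x0 ler01 s0.
have -> : s^-1 + (s / (s - 1))^-1 = 1 by field; apply/andP; split; lra.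
move=> /(_ _ erefl); rewrite divr_gt0 //; last lra.
move=> /(_ isT); rewrite powR1 mulr1 mul1r invf_div.
rewrite -(ler_pM2l s0) mulrDr !mulrA.
have -> : s * x `^ s / s = x `^ s by field; lra.
have -> : s * (s - 1) / s = s - 1 by field; lra.
lra.
Qed.

(** The tangent to the power function at the mean [m] lies below it, by the Bernoulli inequality at
    [f y / m], and averages to [m] to the power [s]. *)
Lemma jensen_powR (R : realType) (V : finType) (k f : V -> R) (s : R) :
  (forall y, 0 <= k y) -> \sum_y k y = 1 -> (forall y, 0 <= f y) -> 1 <= s ->
  (\sum_y k y * f y) `^ s <= \sum_y k y * f y `^ s.
Proof.
move=> k0 k1 f0 s1; set m := \sum_y _.
have s0 : s != 0 by rewrite gt_eqF //; lra.
have : 0 <= m by apply: sumr_ge0 => y _; rewrite mulr_ge0.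
rewrite le_eqVlt => /predU1P[<-|m0].
  by rewrite powR0 //; apply: sumr_ge0 => y _; rewrite mulr_ge0 ?powR_ge0.
have -> : m `^ s = \sum_y k y * (m `^ s * (1 + s * (f y / m - 1))).
  transitivity (\sum_y (m `^ s * (1 - s) * k y + m `^ s * s / m * (k y * f y))).
    rewrite big_split -!mulr_sumr k1 -/m /=; field; lra.
  by apply: eq_bigr => y _; ring.
apply: ler_sum => y _; rewrite ler_wpM2l //.
have -> : f y `^ s = m `^ s * (f y / m) `^ s.
  by rewrite -powRM ?divr_ge0 // ?(ltW m0) // mulrC divfK // gt_eqF.
by rewrite ler_wpM2l ?powR_ge0 // bernoulli_powR ?divr_ge0 // ltW.
Qed.

(* Apply the logarithmic Sobolev inequality to [v = f `^ (p * (1 + l) / 2)]: by Jensen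
   [(K f) `^ (p * (1 + l)) <= (K v) ^+ 2], and the entropy of [v ^+ 2 = g `^ (1 + l)],
   [g = f `^ p], dominates because the entropy of [g `^ (1 + l) / M] relative to [g]
   is nonnegative. *)
Lemma hypercontractive (R : realType) (V : finType) (mu : mmeas R V)
    (K : mkernel R V) (l p : R) (f : V -> R) :
  markov_kernel K -> (forall x, 0 <= mu x) -> (forall x, 0 < mact mu K x) ->
  0 <= l ->
  (forall v, l * entropyL (mact mu K) v <= dirichlet (adjK_K mu K) (mact mu K) v) ->
  2 <= p -> (forall x, 0 <= f x) ->
  \sum_x f x `^ p * mact mu K x <= 1 ->
  \sum_x kact K f x `^ (p * (1 + l)) * mu x <= 1.
Proof.
move=> mK mu0 nu_gt0 l0 lsi p2 f0 fp.
have [K0 K1] := mK.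
set nu := mact mu K in nu_gt0 lsi fp *.
have nu0 x : 0 <= nu x by rewrite ltW.
pose s := p * (1 + l) / 2.
have s1 : 1 <= s by rewrite /s ler_pdivlMr // mul1r -[2]mulr1 ler_pM //; lra.
have sqr_powRs (a : R) : (a `^ s) ^+ 2 = a `^ (p * (1 + l)).
  rewrite -powR_mulrn ?powR_ge0 // -powRrM; congr (_ `^ _).
  by rewrite /s divfK // pnatr_eq0.
pose v x := f x `^ s; pose g x := f x `^ p.
have g0 x : 0 <= g x by exact: powR_ge0.
have v2 x : v x ^+ 2 = g x `^ (1 + l) by rewrite sqr_powRs /g powRrM.
set M := l2norm2 nu v.
have M0 : 0 <= M by apply: sumr_ge0 => x _; rewrite mulr_ge0 ?sqr_ge0.
have E0 : 0 <= dirichlet (adjK_K mu K) nu v.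
  by apply: dirichlet_ge0 => // x y; exact: adjK_K_ge0.
have le_ME : \sum_x kact K f x `^ (p * (1 + l)) * mu x <=
    M - dirichlet (adjK_K mu K) nu v.
  rewrite dirichlet_adjK_K_variance // -/nu -/(l2norm2 nu v) -/M opprB addrCA subrr addr0.
  apply: ler_sum => x _; rewrite mulrC ler_wpM2l // -sqr_powRs.
  rewrite lerXn2r ?nnegrE ?powR_ge0 ?jensen_powR //.
  by apply: sumr_ge0 => y _; rewrite mulr_ge0 ?powR_ge0.
apply: le_trans le_ME _.
move: M0; rewrite le_eqVlt => /predU1P[<-|M_gt0]; first by lra.
(* Then the left side is at most [M - M * ln M], hence at most 1. *)
suff H : M * ln M <= l * entropyL nu v.
  have := lsi v; have := ler_subr_mulr_ln (ltW M_gt0) ltr01; rewrite divr1; lra.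
(* The first term has nonnegative integral since [g] has mass at most 1, and the second integrates
   to [M * ln M]; the comparison with the entropy is then pointwise. *)
apply: (@le_trans _ _ (\sum_x ((1 + l) * (v x ^+ 2 - M * g x) + v x ^+ 2 * ln M) * nu x)).
  have -> : \sum_x ((1 + l) * (v x ^+ 2 - M * g x) + v x ^+ 2 * ln M) * nu x =
      (1 + l) * (M - M * \sum_x g x * nu x) + M * ln M.
    rewrite /M /l2norm2 [X in _ = _ + X]mulr_suml -/(l2norm2 nu v) -/M.
    rewrite mulr_sumr -sumrB mulr_sumr -big_split /=.
    by apply: eq_bigr => x _; ring.
  by rewrite lerDr mulr_ge0 ?subr_ge0 ?ler_piMr //; lra.
rewrite /entropyL mulr_sumr; apply: ler_sum => x _.
rewrite [leRHS]mulrA ler_wpM2r // -/M v2.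
have := g0 x; rewrite le_eqVlt => /predU1P[<-|gx].
  by rewrite powR0 ?gt_eqF //; lra.
have t0 : 0 < g x `^ (1 + l) by rewrite powR_gt0.
have := ler_subr_mulr_ln (ltW t0) (mulr_gt0 M_gt0 gx).
rewrite !ln_div ?posrE ?mulr_gt0 // lnM ?posrE // ln_powR => le_t.
have := ler_wpM2l (_ : 0 <= 1 + l) le_t; rewrite addr_ge0 // => /(_ isT).
lra.
Qed.

(** * Spectral gap *)

Lemma eq_second_eig (R : realType) (n : nat) (A B : 'M[R]_n) :
  char_poly A = char_poly B -> second_eig A = second_eig B.
Proof. by rewrite /second_eig /eigen_seq => ->. Qed.

Lemma big_enum_valT (R : realType) (V : finType) (F : V -> R) :
  \sum_(i < #|V|) F (enum_val i) = \sum_x F x.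
Proof. by rewrite -(big_enum_val F); apply: eq_bigl => x; rewrite inE. Qed.

(* [kmx (adjK_K mu K)] is conjugate by [diag (sqrt nu)] to the symmetric matrix [S],
   which fixes [sqrt nu]. *)
Lemma spectral_gap_sigma1 (R : realType) (V : finType) (mu : mmeas R V)
    (K : mkernel R V) (f : V -> R) :
  V -> markov_kernel K -> (forall x, 0 <= mu x) -> (forall x, 0 < mact mu K x) ->
  \sum_x f x * mact mu K x = 0 ->
  (1 - sigma1 mu K ^+ 2) * (\sum_x f x ^+ 2 * mact mu K x) <=
  dirichlet (adjK_K mu K) (mact mu K) f.
Proof.
move=> x0 mK mu0 nu_gt0 f_mean.
have [K0 K1] := mK.
set nu := mact mu K in nu_gt0 f_mean *.
have nu0 x : 0 <= nu x by rewrite ltW.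
pose W x y := \sum_z mu z * K z x * K z y.
have W_sum y : \sum_x W x y = nu y.
  rewrite /W exchange_big /=; apply: eq_bigr => z _.
  by rewrite -mulr_suml -mulr_sumr K1 mulr1.
have WC x y : W x y = W y x by apply: eq_bigr => z _; ring.
pose r x := Num.sqrt (nu x).
have r_gt0 x : 0 < r x by rewrite sqrtr_gt0.
have r0 x : r x != 0 by rewrite gt_eqF.
have r2 x : r x ^+ 2 = nu x by rewrite sqr_sqrtr.
have nuW x y : (nu x)^-1 * W x y = adjK_K mu K x y by [].
pose S : 'M[R]_#|V| := \matrix_(i, j) (W (enum_val i) (enum_val j) / (r (enum_val i) * r (enum_val j))).
pose D : 'M[R]_#|V| := diag_mx (\row_i r (enum_val i)).
pose D' : 'M[R]_#|V| := diag_mx (\row_i (r (enum_val i))^-1).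
have DD' : D *m D' = 1%:M.
  rewrite mulmx_diag; apply/matrixP => i j; rewrite !mxE.
  by case: eqP => [->|]; rewrite ?mulr0n // mulr1n divff.
have S_eig : second_eig S = second_eig (kmx (adjK_K mu K)).
  apply: eq_second_eig; rewrite -(char_poly_conj (kmx _) DD'); congr char_poly.
  rewrite mul_diag_mx mul_mx_diag; apply/matrixP => i j; rewrite !mxE -nuW -r2.
  by field; rewrite !r0.
pose v : 'rV[R]_#|V| := \row_i r (enum_val i).
pose F : 'rV[R]_#|V| := \row_i (f (enum_val i) * r (enum_val i)).
have FF : (F *m F^T) 0 0 = \sum_x f x ^+ 2 * nu x.
  rewrite mxE -[RHS]big_enum_valT; apply: eq_bigr => i _.
  by rewrite !mxE -r2; ring.
have FSF : (F *m S *m F^T) 0 0 = \sum_z mu z * kact K f z ^+ 2.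
  transitivity (\sum_y \sum_x f x * W x y * f y).
    rewrite mxE -[RHS]big_enum_valT; apply: eq_bigr => j _.
    rewrite !mxE -[RHS]big_enum_valT mulr_suml; apply: eq_bigr => i _.
    by rewrite !mxE; field; rewrite !r0.
  under [RHS]eq_bigr => z _ do rewrite expr2 {2}/kact mulrA mulr_sumr.
  rewrite [RHS]exchange_big /=; apply: eq_bigr => y _.
  under eq_bigr => x _ do rewrite /W mulr_sumr mulr_suml.
  rewrite exchange_big /=; apply: eq_bigr => z _.
  rewrite /kact mulr_sumr mulr_suml; apply: eq_bigr => x _.
  ring.
have FSF_le : (F *m S *m F^T) 0 0 <= (F *m F^T) 0 0.
  rewrite FF FSF -subr_ge0 -dirichlet_adjK_K_variance //.
  by apply: dirichlet_ge0 => // x y; exact: adjK_K_ge0.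
have ST : S^T = S by apply/matrixP => i j; rewrite !mxE WC [r _ * r _]mulrC.
have v0 : v != 0.
  apply/eqP => /rowP/(_ (enum_rank x0)); rewrite !mxE => /eqP.
  by rewrite (negPf (r0 _)).
have vS : v *m S = v.
  apply/rowP => j; rewrite !mxE.
  transitivity (\sum_(i < #|V|) W (enum_val i) (enum_val j) / r (enum_val j)).
    by apply: eq_bigr => i _; rewrite !mxE; field; rewrite !r0.
  rewrite -mulr_suml (big_enum_valT (W^~ (enum_val j))) W_sum -r2 expr2 mulfK //.
have Fv : F *m v^T = 0.
  apply/matrixP => i j; rewrite !mxE -[RHS]f_mean -[RHS]big_enum_valT; apply: eq_bigr => k _.
  by rewrite !mxE -r2; ring.
have := second_eig_rayleigh ST v0 vS Fv FSF_le.
rewrite S_eig FF FSF dirichlet_adjK_K_variance // -/nu => le_eig.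
have f2_ge0 : 0 <= \sum_x f x ^+ 2 * nu x.
  by apply: sumr_ge0 => x _; rewrite mulr_ge0 ?sqr_ge0.
(* [Num.sqrt] sends negative numbers to 0, so [sigma1] squared is the positive part of the
   eigenvalue. *)
have eig_le : second_eig (kmx (adjK_K mu K)) <= sigma1 mu K ^+ 2.
  rewrite /sigma1; have [e0|e0] := leP 0 (second_eig (kmx (adjK_K mu K))).
    by rewrite sqr_sqrtr.
  by rewrite (le_trans (ltW e0)) ?sqr_ge0.
have := ler_wpM2r f2_ge0 eig_le.
rewrite mulrBl mul1r; lra.
Qed.

(* The density step is [h |-> K^* h] with [K^*] the adjoint of [K : l^2(mu K) -> l^2(mu)];
   [|K^* g|^2 = <g, K K^* g>] reduces its contraction to that of [K] on mean-zero functions. *)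
Lemma adjoint_contraction (R : realType) (V : finType) (mu : mmeas R V)
    (K : mkernel R V) (g w : V -> R) (rho : R) :
  0 < rho -> markov_kernel K -> (forall x, 0 <= mu x) -> (forall x, 0 < mact mu K x) ->
  (forall y, w y * mact mu K y = \sum_z mu z * K z y * g z) ->
  (1 - rho) * (\sum_x w x ^+ 2 * mact mu K x) <= dirichlet (adjK_K mu K) (mact mu K) w ->
  \sum_x w x ^+ 2 * mact mu K x <= rho * \sum_x g x ^+ 2 * mu x.
Proof.
move=> rho_gt0 mK mu0 nu_gt0 wE; rewrite dirichlet_adjK_K_variance //.
set S := \sum_x w x ^+ 2 * _; set T := \sum_z mu z * _; set G := \sum_x _ * _ => gap.
have SE : S = \sum_z mu z * (g z * kact K w z).
  rewrite /S; under eq_bigr => y _ do rewrite expr2 -mulrA wE mulr_sumr.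
  rewrite exchange_big /=; apply: eq_bigr => z _; rewrite /kact !mulr_sumr.
  by apply: eq_bigr => y _; ring.
(* Cauchy-Schwarz with weight [rho], by completing the square; the gap hypothesis says
   [T <= rho * S], which absorbs the last term. *)
have : 2 * S <= rho * G + T / rho.
  rewrite SE /G /T !mulr_sumr mulr_suml -big_split /=; apply: ler_sum => z _.
  have -> : rho * (g z ^+ 2 * mu z) + mu z * kact K w z ^+ 2 / rho =
      mu z * (rho * (g z - kact K w z / rho) ^+ 2 + 2 * (g z * kact K w z)).
    by field; rewrite gt_eqF.
  rewrite mulrCA ler_wpM2l // lerDr mulr_ge0 ?sqr_ge0 //; exact: ltW.
have : T / rho <= S by rewrite ler_pdivrMr //; lra.
lra.
Qed.

(** * Stable sequences *)

Section StableSequence.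
Variables (R : realType) (V : finType) (c : R).
Variables (K : nat -> mkernel R V) (mu0 : mmeas R V).
Hypothesis c_gt1 : 1 < c.
Hypothesis K_markov : forall i, (1 <= i)%N -> markov_kernel (K i).
Hypothesis mu0_prob : positive_prob mu0.
Hypothesis K_stable : c_stable c K mu0.

Let mu n := mact mu0 (Kprod K n).

Let c_gt0 : 0 < c. Proof. exact: lt_trans c_gt1. Qed.

Let muS n : mact (mu n) (K n.+1) = mu n.+1.
Proof. by rewrite /mu /= mact_kcomp. Qed.

(** * Marginals of the chain compared with [mu0] *)

Lemma marginal_gt0 n x : 0 < mu n x.
Proof.
have [mu0_gt0 _] := mu0_prob; have /andP[le_c _] := K_stable n x.
rewrite -(pmulr_lgt0 _ (_ : 0 < (mu0 x)^-1)) ?invr_gt0 //.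
by apply: lt_le_trans le_c; rewrite invr_gt0.
Qed.

Lemma marginal_sum1 n : \sum_x mu n x = 1.
Proof.
elim: n => [|n IHn]; first by rewrite /mu mact_kid; case: mu0_prob.
rewrite -muS -IHn; transitivity (\sum_x 1 * mact (mu n) (K n.+1) x).
  by apply: eq_bigr => x _; rewrite mul1r.
rewrite sum_mact; apply: eq_bigr => x _; rewrite /kact.
by under eq_bigr do rewrite mulr1; rewrite (K_markov (ltn0Sn n)).2 mulr1.
Qed.

Lemma marginal_le n x : mu n x <= c * mu0 x.
Proof.
have /andP[_] := K_stable n x.
by rewrite ler_pdivrMr //; case: mu0_prob.
Qed.

Lemma marginal_ge n x : c^-1 * mu0 x <= mu n x.
Proof.
have /andP[+ _] := K_stable n x.
by rewrite ler_pdivlMr //; case: mu0_prob.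
Qed.

Lemma marginal_le_mact n x : mu n.+1 x <= c * mact mu0 (K n.+1) x.
Proof.
rewrite -muS /mact mulr_sumr; apply: ler_sum => y _.
by rewrite mulrA ler_wpM2r ?marginal_le // (K_markov (ltn0Sn n)).1.
Qed.

Lemma mact_mu0_gt0 n x : 0 < mact mu0 (K n.+1) x.
Proof.
by rewrite -(pmulr_rgt0 _ c_gt0) (lt_le_trans (marginal_gt0 n.+1 x)) // marginal_le_mact.
Qed.

Lemma mact_mu0_sum1 n : \sum_x mact mu0 (K n.+1) x = 1.
Proof.
transitivity (\sum_x 1 * mact mu0 (K n.+1) x).
  by apply: eq_bigr => x _; rewrite mul1r.
have [_ mu01] := mu0_prob; rewrite -[RHS]mu01 sum_mact; apply: eq_bigr => x _; rewrite /kact.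
by under eq_bigr do rewrite mulr1; rewrite (K_markov (ltn0Sn n)).2 mulr1.
Qed.

(** * Logarithmic Sobolev inequality and hypercontractivity along the marginals *)

Let mu0_ge0 x : 0 <= mu0 x. Proof. by case: mu0_prob => /(_ x) /ltW. Qed.

Let dirichlet_mu_ge n f :
  c^-1 * dirichlet (adjK_K mu0 (K n.+1)) (mact mu0 (K n.+1)) f <=
  dirichlet (adjK_K (mu n) (K n.+1)) (mact (mu n) (K n.+1)) f.
Proof.
apply: ler_dirichlet; first exact: (K_markov (ltn0Sn n)).1.
- exact: mact_mu0_gt0.
- by move=> x; rewrite muS marginal_gt0.
- exact: marginal_ge.
Qed.

Let adjK_K0_ge0 n x y : 0 <= adjK_K mu0 (K n.+1) x y.
Proof. by apply: adjK_K_ge0 => //; exact: (K_markov (ltn0Sn n)).1. Qed.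

Definition stable_logsob n := c ^- 2 * logsob (adjK_K mu0 (K n)) (mact mu0 (K n)).

Lemma stable_logsob_ge0 n : 0 <= stable_logsob n.+1.
Proof.
rewrite /stable_logsob mulr_ge0 ?invr_ge0 ?exprn_ge0 ?(ltW c_gt0) //.
by apply: logsob_ge0 (mact_mu0_sum1 n) => [|x]; [exact: adjK_K0_ge0|rewrite ltW ?mact_mu0_gt0].
Qed.

(** Each power of [c] in [c ^- 2] pays for one comparison: the Dirichlet form through
    [mu n >= c^-1 * mu0], the entropy through [mu n.+1 <= c * mact mu0 (K n.+1)]. *)
Lemma stable_logsob_inequality n f :
  stable_logsob n.+1 * entropyL (mu n.+1) f <=
  dirichlet (adjK_K (mu n) (K n.+1)) (mu n.+1) f.
Proof.
have nu0 x : 0 <= mact mu0 (K n.+1) x by rewrite ltW ?mact_mu0_gt0.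
rewrite -[X in _ <= dirichlet _ X _]muS; apply: le_trans (dirichlet_mu_ge n f).
apply: (@le_trans _ _ (stable_logsob n.+1 * (c * entropyL (mact mu0 (K n.+1)) f))).
  apply: ler_wpM2l; first exact: stable_logsob_ge0.
  apply: ler_entropyL (marginal_le_mact n) => //; rewrite ?(ltW c_gt0) ?marginal_sum1 ?mact_mu0_sum1 //.
    exact: mact_mu0_gt0.
  by move=> x; rewrite ltW ?marginal_gt0.
have -> : forall e, stable_logsob n.+1 * (c * e) =
    c^-1 * (logsob (adjK_K mu0 (K n.+1)) (mact mu0 (K n.+1)) * e).
  by move=> e; rewrite /stable_logsob; field; rewrite gt_eqF.
by rewrite ler_wpM2l ?invr_ge0 ?(ltW c_gt0) // logsob_inequality ?mact_mu0_sum1.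
Qed.

(** The kernel [K n.+1] acts on [f] first, moving from [mu n.+1] to [mu n] and raising the exponent;
    the induction therefore keeps [p] and [f] general. *)
Lemma hypercontractive_Kprod n p f : 2 <= p -> (forall x, 0 <= f x) ->
  \sum_x f x `^ p * mu n x <= 1 ->
  \sum_x kact (Kprod K n) f x `^ (p * \prod_(1 <= i < n.+1) (1 + stable_logsob i)) * mu0 x
    <= 1.
Proof.
elim: n p f => [|n IHn] p f p2 f0 fp.
  by rewrite big_geq // mulr1 /= kact_kid; move: fp; rewrite /mu mact_kid.
have l0 := stable_logsob_ge0 n.
rewrite big_nat_recr //= kact_kcomp [X in p * X]mulrC mulrA; apply: IHn.
- by rewrite -[2]mulr1 ler_pM //; lra.
- move=> x; apply: sumr_ge0 => y _.
  by rewrite mulr_ge0 // (K_markov (ltn0Sn n)).1.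
- apply: hypercontractive; rewrite ?muS // ?marginal_gt0 //.
  + exact: K_markov.
  + by move=> x; rewrite ltW ?marginal_gt0.
  + by move=> x; exact: marginal_gt0.
  + by move=> v; exact: stable_logsob_inequality.
Qed.

(** * Densities and the distance to the marginals *)

Let density x n y := Kprod K n x y / mu n y.

Lemma Kprod_ge0 n x y : 0 <= Kprod K n x y.
Proof.
elim: n y => [|n IHn] y /=; first by rewrite /kid; case: ifP.
by apply: sumr_ge0 => z _; rewrite mulr_ge0 // (K_markov (ltn0Sn n)).1.
Qed.

Lemma Kprod_sum1 n x : \sum_y Kprod K n x y = 1.
Proof.
elim: n => [|n IHn] /=.
  by rewrite (bigD1 x) //= /kid eqxx big1 ?addr0 // => y; rewrite eq_sym => /negPf ->.
rewrite -IHn exchange_big /=; apply: eq_bigr => z _.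
by rewrite -mulr_sumr (K_markov (ltn0Sn n)).2 mulr1.
Qed.

Lemma d2_sqr n x :
  d2 (Kprod K n x) (mu n) ^+ 2 = \sum_y (density x n y - 1) ^+ 2 * mu n y.
Proof.
rewrite /d2 sqr_sqrtr //; apply: sumr_ge0 => y _.
by rewrite mulr_ge0 ?sqr_ge0 // ltW ?marginal_gt0.
Qed.

Let densityM x n y : density x n y * mu n y = Kprod K n x y.
Proof. by rewrite /density divfK // gt_eqF // marginal_gt0. Qed.

(** The centred density at time [n.+1] is the adjoint of [K n.+1] applied to the one at time [n], so
    [adjoint_contraction] reduces the claim to a spectral gap for [w]. *)
Lemma d2_contraction n x :
  d2 (Kprod K n.+1 x) (mu n.+1) ^+ 2 <=
  (1 - c ^- 2 * (1 - sigma1 mu0 (K n.+1) ^+ 2)) * d2 (Kprod K n x) (mu n) ^+ 2.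
Proof.
have c2 : 0 < c ^- 2 < 1.
  by rewrite invr_gt0 exprn_gt0 //= invf_lt1 ?exprn_gt0 // exprn_egt1.
set sg := sigma1 _ _ ^+ 2; have sg0 : 0 <= sg by exact: sqr_ge0.
have rho_gt0 : 0 < 1 - c ^- 2 * (1 - sg).
  by have := mulr_ge0 (ltW (andP c2).1) sg0; lra.
have mK := K_markov (ltn0Sn n).
have nu_gt0 := mact_mu0_gt0 n.
rewrite !d2_sqr -muS; apply: adjoint_contraction => //.
- by move=> y; rewrite ltW ?marginal_gt0.
- by move=> y; rewrite muS marginal_gt0.
- move=> y; rewrite muS mulrBl densityM mul1r /= -muS /mact /Defs.kcomp -sumrB.
  by apply: eq_bigr => z _; rewrite -densityM; ring.
rewrite muS opprB addrC subrK.
set w := fun y => density x n.+1 y - 1; set nu := mact mu0 (K n.+1).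
set S := \sum_x w x ^+ 2 * _.
have S0 : 0 <= S by apply: sumr_ge0 => y _; rewrite mulr_ge0 ?sqr_ge0 // ltW ?marginal_gt0.
(* If [sg > 1] the claimed lower bound is nonpositive. *)
have [sg1|sg1] := leP sg 1; last first.
  apply: (@le_trans _ _ 0).
    by rewrite mulr_le0_ge0 // mulr_ge0_le0 ?(ltW (andP c2).1) //; lra.
  apply: dirichlet_ge0 => [z y|y]; last by rewrite ltW ?marginal_gt0.
  by apply: adjK_K_ge0 => [u|]; [rewrite ltW ?marginal_gt0|exact: mK.1].
(* [w] is centred for [mu n.+1] but the gap is known for [nu]. Recentring at the [nu]-mean [m] can
   only increase the second moment under [mu n.+1], and leaves the Dirichlet form unchanged. *)
pose m := \sum_y w y * nu y.
have w_le : S <= c * \sum_y (w y - m) ^+ 2 * nu y.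
  apply: (@le_trans _ _ (\sum_y (w y - m) ^+ 2 * mu n.+1 y)).
    have wmu : \sum_y w y * mu n.+1 y = 0.
      rewrite /w; under eq_bigr do rewrite mulrBl densityM mul1r.
      by rewrite sumrB marginal_sum1 Kprod_sum1 subrr.
    have -> : \sum_y (w y - m) ^+ 2 * mu n.+1 y = S + m ^+ 2.
      transitivity (\sum_y (w y ^+ 2 * mu n.+1 y - 2 * m * (w y * mu n.+1 y)
                            + m ^+ 2 * mu n.+1 y)).
        by apply: eq_bigr => y _; ring.
      by rewrite !big_split /= sumrN -!mulr_sumr wmu marginal_sum1 mulr0 subr0 mulr1.
    by rewrite lerDl sqr_ge0.
  rewrite mulr_sumr; apply: ler_sum => y _.
  by rewrite mulrCA ler_wpM2l ?sqr_ge0 // marginal_le_mact.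
have gap : (1 - sg) * (\sum_y (w y - m) ^+ 2 * nu y) <=
    dirichlet (adjK_K mu0 (K n.+1)) nu w.
  have -> : dirichlet (adjK_K mu0 (K n.+1)) nu w =
            dirichlet (adjK_K mu0 (K n.+1)) nu (fun y => w y - m).
    by congr (_ * _); do 2!apply: eq_bigr => ? _; ring.
  apply: spectral_gap_sigma1 => //.
  under eq_bigr do rewrite mulrBl.
  by rewrite sumrB -mulr_sumr mact_mu0_sum1 mulr1 subrr.
have := dirichlet_mu_ge n w; rewrite muS; apply: le_trans.
apply: (@le_trans _ _ (c ^- 2 * (1 - sg) * (c * \sum_y (w y - m) ^+ 2 * nu y))).
  by rewrite ler_wpM2l // mulr_ge0 ?(ltW (andP c2).1) //; lra.
have -> : forall e, c ^- 2 * (1 - sg) * (c * e) = c^-1 * ((1 - sg) * e).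
  by move=> e; field; rewrite gt_eqF.
by rewrite ler_wpM2l // invr_ge0 ltW.
Qed.

Lemma density_l2_le n x :
  mtilde_cond c K mu0 x n -> \sum_y density x n y ^+ 2 * mu n y <= expR 2.
Proof.
rewrite /mtilde_cond => cond.
have mu0x : 0 < mu0 x by case: mu0_prob.
have l0 i : (1 <= i)%N -> 0 <= stable_logsob i.
  by case: i => // i _; exact: stable_logsob_ge0.
set Pi := \prod_(1 <= i < n.+1) (1 + stable_logsob i).
have Pi_ge1 : 1 <= Pi.
  rewrite /Pi big_nat_cond; elim/big_ind: _ => // [a b a1 b1|i].
    by rewrite -[1]mulr1 ler_pM.
  by rewrite andbT => /andP[/l0 li _]; rewrite lerDl.
have lnPi : ln Pi = \sum_(1 <= i < n.+1) ln (1 + stable_logsob i).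
  suff : 0 < Pi /\ ln Pi = \sum_(1 <= i < n.+1) ln (1 + stable_logsob i) by case.
  rewrite /Pi big_nat_cond [X in _ = X]big_nat_cond.
  elim/big_rec2: _ => [|i a b]; first by rewrite ln1.
  rewrite andbT => /andP[/l0 li _] [b0 <-].
  by rewrite mulr_gt0 ?lnM ?posrE //; lra.
have le_Pi : ln (mu0 x `^ (- 2^-1)) <= Pi.
  (* If the inner logarithm is nonpositive, its own [ln] is 0 by convention and [cond] says nothing
     about its size; [1 <= Pi] settles this case. *)
  have [L0|L0] := leP (ln (mu0 x `^ (- 2^-1))) 0; first by lra.
  by rewrite -ler_ln ?posrE ?lnPi //; lra.
have {}le_Pi : - ln (mu0 x) <= 2 * Pi by move: le_Pi; rewrite ln_powR; lra.
set S := \sum_y _.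
have S0 : 0 <= S by apply: sumr_ge0 => y _; rewrite mulr_ge0 ?sqr_ge0 // ltW ?marginal_gt0.
move: S0; rewrite le_eqVlt => /predU1P[<-|S_gt0]; first exact: expR_ge0.
pose N := Num.sqrt S; have N_gt0 : 0 < N by rewrite sqrtr_gt0.
have N2 : N ^+ 2 = S by rewrite sqr_sqrtr // ltW.
pose f y := density x n y / N.
have f0 y : 0 <= f y by rewrite divr_ge0 ?(ltW N_gt0) // divr_ge0 ?Kprod_ge0 // ltW ?marginal_gt0.
have f2 : \sum_y f y `^ 2 * mu n y <= 1.
  have -> : \sum_y f y `^ 2 * mu n y = S / N ^+ 2.
    rewrite /S mulr_suml; apply: eq_bigr => y _.
    by rewrite powR_mulrn // /f expr_div_n mulrAC.
  by rewrite N2 divff // gt_eqF.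
(* [K_{0,n} f] at [x] pairs [f] with the density in l^2 of [mu n], so the normalised density
   recovers the norm [N]. *)
have Kf : kact (Kprod K n) f x = N.
  transitivity (S / N); last by rewrite -N2 expr2 mulfK // gt_eqF.
  rewrite /S mulr_suml; apply: eq_bigr => y _.
  by rewrite -densityM /f; ring.
have le_N : N `^ (2 * Pi) * mu0 x <= 1.
  apply: le_trans (hypercontractive_Kprod (lexx 2) f0 f2).
  rewrite (bigD1 x) //= Kf lerDl; apply: sumr_ge0 => y _.
  by rewrite mulr_ge0 ?powR_ge0.
have : ln (N `^ (2 * Pi) * mu0 x) <= 0 by rewrite ln_le0.
rewrite lnM ?posrE ?powR_gt0 // ln_powR => le_lnN.
have lnN1 : ln N <= 1.
  rewrite -(ler_pM2l (_ : 0 < 2 * Pi)) //; lra.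
have N_le : N <= expR 1 by rewrite -[N]lnK ?posrE // ler_expR.
rewrite -N2 (_ : 2 = 1 + 1 :> R) // expRD -expr2 lerXn2r // nnegrE ?expR_ge0 //.
exact: ltW.
Qed.

(** The density has mean 1 under [mu n], so the left side is its variance, one less than its second
    moment. *)
Lemma d2_sqr_le n x :
  d2 (Kprod K n x) (mu n) ^+ 2 <= \sum_y density x n y ^+ 2 * mu n y.
Proof.
rewrite d2_sqr.
have -> : \sum_y (density x n y - 1) ^+ 2 * mu n y =
    \sum_y density x n y ^+ 2 * mu n y - 1.
  transitivity (\sum_y (density x n y ^+ 2 * mu n y - 2 * Kprod K n x y + mu n y)).
    by apply: eq_bigr => y _; rewrite -densityM; ring.
  by rewrite !big_split /= sumrN -mulr_sumr marginal_sum1 Kprod_sum1; ring.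
lra.
Qed.

Lemma d2_product_bound mt n x : mtilde_cond c K mu0 x mt -> (mt <= n)%N ->
  d2 (Kprod K n x) (mu n) ^+ 2 <=
  expR 2 * \prod_(mt.+1 <= i < n.+1) (1 - c ^- 2 * (1 - sigma1 mu0 (K i) ^+ 2)).
Proof.
move=> cond; elim: n => [|n IHn].
  rewrite leqn0 => /eqP mt0; rewrite mt0 in cond *.
  by rewrite big_geq // mulr1 (le_trans (d2_sqr_le _ _)) // density_l2_le.
rewrite leq_eqVlt => /predU1P[mtn|mt_le].
  by rewrite mtn in cond *; rewrite big_geq // mulr1 (le_trans (d2_sqr_le _ _)) // density_l2_le.
rewrite big_nat_recr //= mulrA (le_trans (d2_contraction _ _)) // mulrC ler_wpM2r ?IHn //.
(* The contraction factor must be nonnegative for the induction hypothesis to be multiplied by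
   it. *)
have : c ^- 2 <= 1 by rewrite invf_le1 ?exprn_gt0 // exprn_ege1 // ltW.
have : 0 <= c ^- 2 by rewrite invr_ge0 exprn_ge0 // ltW.
move=> c0 c1; have := mulr_ge0 c0 (sqr_ge0 (sigma1 mu0 (K n.+1))); lra.
Qed.

End StableSequence.

Theorem theorem4p6 (R : realType) (V : finType) (c : R)
  (K : nat -> mkernel R V) (mu0 : mmeas R V) :
  1 < c ->
  (forall i, (1 <= i)%N -> markov_kernel (K i) /\ irreducible_kernel (K i)) ->
  positive_prob mu0 ->
  c_stable c K mu0 ->
  forall (x : V) (mt : nat),
    mtilde_cond c K mu0 x mt ->
    (forall t, (t < mt)%N -> ~ mtilde_cond c K mu0 x t) ->
    forall n : nat, (mt <= n)%N ->
      d2 (Kprod K n x) (mact mu0 (Kprod K n)) ^+ 2 <=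
      expR 2 * \prod_(mt.+1 <= i < n.+1)
                 (1 - c ^- 2 * (1 - sigma1 mu0 (K i) ^+ 2)).
Proof.
move=> c_gt1 mK mu0_prob K_stable x mt cond _ n.
apply: d2_product_bound => // i /mK [] //.
Qed.
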